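(* Let $3\leq l\leq t$ be integers. If $s$ is sufficiently large (in terms of $l$ and $t$) and $n\geq s+(t-1)\binom{s}{l}+1$, then $$ex(n,\{K_{l,t},M_{s+1}\})=(l-1)n+(t-1)\binom{s}{l}-\left\lceil\frac{s(l-1)}{2}\right\rceil.$$
   Context: All graphs are finite and simple. $ex(n,\mathscr{F})$ is the maximum number of edges of an $n$-vertex graph containing no member of the family $\mathscr{F}$ as a subgraph. $K_{l,t}$ is the complete bipartite graph with parts of sizes $l$ and $t$, and $M_{s+1}$ is the matching of $s+1$ pairwise disjoint edges. (The quantity $s+(t-1)\binom{s}{l}+1$ is denoted $n(s)$ in the paper.) *)

(* Defs.v *)
From mathcomp Require Import all_boot.
Set Implicit Arguments. Unset Strict Implicit. Unset Printing Implicit Defensive.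

Definition simple_graph (n : nat) (E : {set {set 'I_n}}) : bool :=
  [forall e in E, #|e| == 2].

Definition has_Klt (n l t : nat) (E : {set {set 'I_n}}) : bool :=
  [exists A : {set 'I_n}, exists B : {set 'I_n},
    [&& #|A| == l, #|B| == t, [disjoint A & B] &
        [forall a in A, forall b in B, [set a; b] \in E]]].

Definition has_matching (n k : nat) (E : {set {set 'I_n}}) : bool :=
  [exists M : {set {set 'I_n}}, [&& M \subset E, #|M| == k & trivIset M]].

Definition ex_Klt_M (n l t s : nat) : nat :=
  \max_(E : {set {set 'I_n}} |
          [&& simple_graph E, ~~ has_Klt l t E & ~~ has_matching s.+1 E])
     #|E|.

(* Main.v *)
Require Import Defs.
From mathcomp Require Import all_boot zify.
Set Implicit Arguments. Unset Strict Implicit. Unset Printing Implicit Defensive.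

(** Upper bound.  Let [M] be a maximum matching.  The unmatched vertices are
   independent, and an edge of [M] has at most one endpoint with two or more
   unmatched neighbours; call such endpoints heavy, so there are [h <= #|M| <=
   s] of them.  Counting stars, [sum_v C(d_X(v), l) <= (t - 1) C(#|X|, l)] for
   every vertex set [X], and [d <= (l - 1) + C(d, l)].  If [h = s], an
   alternating path argument shows that the heavy vertices form a vertex cover
   [S]; the star count with [X = S], applied to the vertices outside [S] and
   inside [S] alike, is then exactly the claimed bound.  If [h < s], the star
   count loses [(t - 1) C(s - 1, l - 1)], which for large [s] exceeds the number
   of edges spanned by the [2 #|M|] matched vertices; for [l = t = 3] both are
   quadratic in [s], so this needs a Kővári–Sós–Turán type estimate.

   Lower bound.  Put on an [s]-set [S] a graph of maximum degree [l - 1] with as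
   many edges as parity allows, join [t - 1] outside vertices to each [l]-subset
   of [S], and every other outside vertex to one fixed [(l - 1)]-subset. *)

(** * Stars and matchings *)

Definition nbr (T : finType) (E : {set {set T}}) (x : T) : {set T} :=
  [set y | [set x; y] \in E].

Definition simple (T : finType) (E : {set {set T}}) : Prop :=
  {in E, forall e : {set T}, #|e| = 2}.

Definition incident (T : finType) (E : {set {set T}}) (x : T) : {set {set T}} :=
  [set e in E | x \in e].

Lemma in_nbr (T : finType) (E : {set {set T}}) (x y : T) :
  (y \in nbr E x) = ([set x; y] \in E).
Proof. by rewrite inE. Qed.

Lemma in_nbrC (T : finType) (E : {set {set T}}) (x y : T) :
  (y \in nbr E x) = (x \in nbr E y).
Proof. by rewrite !inE setUC. Qed.

Lemma simple_neq (T : finType) (E : {set {set T}}) (x y : T) :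
  simple E -> [set x; y] \in E -> x != y.
Proof. by move=> sE /sE; rewrite cards2; case: (x != y). Qed.

Lemma edge_other_end (T : finType) (e : {set T}) (x : T) :
  #|e| = 2 -> x \in e -> exists2 y, x != y & e = [set x; y].
Proof.
move=> /eqP/cards2P[a [b [ab ->]]]; rewrite !inE => /orP[]/eqP->.
  by exists b.
by exists a; [rewrite eq_sym | rewrite setUC].
Qed.

Lemma set2_inj (T : finType) (x y z : T) : [set x; y] = [set x; z] -> y = z.
Proof.
move=> eq_xyz; have: y \in [set x; z] by rewrite -eq_xyz !inE eqxx orbT.
rewrite !inE => /orP[]/eqP // yx; move: eq_xyz; rewrite yx setUid => /setP/(_ z).
by rewrite !inE eqxx orbT => /eqP.
Qed.

Lemma card_incident (T : finType) (E : {set {set T}}) (x : T) :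
  simple E -> #|incident E x| = #|nbr E x|.
Proof.
move=> sE; rewrite -(@card_in_imset _ _ (fun y => [set x; y]) (nbr E x)).
  apply: eq_card => e; rewrite !inE; apply/andP/imsetP => [[eE xe]|[y]].
    have [y _ def_e] := edge_other_end (sE _ eE) xe.
    by exists y; rewrite ?inE -?def_e.
  by rewrite inE => xyE ->; rewrite xyE !inE eqxx.
by move=> y z _ _; apply: set2_inj.
Qed.

Lemma sum_card_set (I J : finType) (A : {set I}) (B : {set J}) (r : I -> J -> bool) :
  \sum_(i in A) #|[set j in B | r i j]| = \sum_(j in B) #|[set i in A | r i j]|.
Proof.
have swapE (K L : finType) (C : {set K}) (D : {set L}) q :
  \sum_(k in C) #|[set l in D | q k l]| = \sum_(k in C) \sum_(l in D) q k l.
  apply: eq_bigr => k _; rewrite -sum1_card -big_mkcondr /=.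
  by apply: eq_bigl => l; rewrite !inE.
by rewrite swapE exchange_big -(swapE _ _ _ _ (fun j i => r i j)).
Qed.

Lemma sum_card_nbr (T : finType) (E : {set {set T}}) :
  simple E -> \sum_x #|nbr E x| = 2 * #|E|.
Proof.
move=> sE; under eq_bigr do rewrite -card_incident //.
have := sum_card_set setT E (fun x e => x \in e).
under eq_bigl do rewrite inE; move=> ->.
rewrite mulnC -sum_nat_const; apply: eq_bigr => e eE; rewrite -(sE e eE).
by apply: eq_card => x; rewrite !inE.
Qed.

Lemma sum_nbr_swap (T : finType) (E : {set {set T}}) (A B : {set T}) :
  \sum_(x in A) #|nbr E x :&: B| = \sum_(x in B) #|nbr E x :&: A|.
Proof.
have nbrE (C : {set T}) x : nbr E x :&: C = [set y in C | y \in nbr E x].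
  by apply/setP=> y; rewrite in_setI [RHS]in_set andbC.
under eq_bigr do rewrite nbrE.
rewrite sum_card_set; apply: eq_bigr => x _; rewrite nbrE.
by apply: eq_card => y; rewrite in_set [RHS]in_set in_nbrC.
Qed.

(** An edge inside the cover [S] is seen from both ends, any other edge only from its end outside
    [S], hence the weight 2. *)
Lemma sum_nbr_cover (T : finType) (E : {set {set T}}) (S : {set T}) :
    simple E ->
    (forall x y, [set x; y] \in E -> (x \in S) || (y \in S)) ->
  2 * #|E| = \sum_(x in S) #|nbr E x :&: S| + 2 * \sum_(x in ~: S) #|nbr E x :&: S|.
Proof.
move=> sE covS; rewrite -sum_card_nbr // (bigID [in S]) /=.
have -> : \sum_(x in S) #|nbr E x| =
    \sum_(x in S) #|nbr E x :&: S| + \sum_(x in S) #|nbr E x :&: ~: S|.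
  by rewrite -big_split; apply: eq_bigr => x _; rewrite /= -setDE cardsID.
rewrite (sum_nbr_swap E S) -addnA mul2n -addnn; congr (_ + (_ + _)).
apply: eq_big => x; first by rewrite inE.
move=> xS; apply: eq_card => y; rewrite [RHS]in_setI andb_idr //.
by rewrite inE => /covS; rewrite (negPf xS).
Qed.

(** Disjointness of the two parts is automatic in a simple graph, where no vertex is its own
    neighbour. *)
Definition Klt_free (T : finType) (l t : nat) (E : {set {set T}}) : Prop :=
  forall A : {set T}, #|A| = l -> #|[set x | A \subset nbr E x]| < t.

Lemma has_KltPn (n l t : nat) (E : {set {set 'I_n}}) :
  simple E -> reflect (Klt_free l t E) (~~ has_Klt l t E).
Proof.
move=> sE; apply: (iffP idP) => [noK A cA|freeE].
  rewrite ltnNge; apply: contra noK => leB.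
  have [B] : exists B : {set 'I_n}, B \subset [set x | A \subset nbr E x] /\ #|B| = t.
    have /set0Pn[B] : [set B : {set 'I_n} |
        B \subset [set x | A \subset nbr E x] & #|B| == t] != set0.
      by rewrite -card_gt0 cards_draws bin_gt0.
    by rewrite !inE => /andP[? /eqP ?]; exists B.
  move=> [/subsetP sB cB].
  have ABE a b : a \in A -> b \in B -> [set a; b] \in E.
    by move=> aA /sB; rewrite inE => /subsetP/(_ _ aA); rewrite inE setUC.
  apply/existsP; exists A; apply/existsP; exists B; rewrite cA cB !eqxx /=.
  apply/andP; split.
    rewrite disjoint_subset; apply/subsetP => x xA; rewrite inE; apply/negP => xB.
    by have := simple_neq sE (ABE _ _ xA xB); rewrite eqxx.
  by apply/forall_inP => a aA; apply/forall_inP => b bB; apply: ABE.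
apply/existsP => -[A /existsP[B /and4P[/eqP cA /eqP cB _ /forall_inP ABE]]].
have := freeE A cA; rewrite ltnNge -cB subset_leq_card //.
apply/subsetP => b bB; rewrite inE; apply/subsetP => a aA.
by rewrite inE setUC; have /forall_inP := ABE a aA; apply.
Qed.

(** Double counting of pairs of a vertex and an [l]-subset of [W] in its neighbourhood; each subset
    has at most [t - 1] common neighbours. *)
Lemma sum_bin_nbr (T : finType) (l t : nat) (E : {set {set T}}) (W : {set T}) :
  Klt_free l t E -> \sum_x 'C(#|nbr E x :&: W|, l) <= (t - 1) * 'C(#|W|, l).
Proof.
move=> freeE.
have -> : \sum_x 'C(#|nbr E x :&: W|, l) =
    \sum_(x in setT) #|[set A in [set A : {set T} | A \subset W & #|A| == l] |
                         A \subset nbr E x]|.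
  apply: eq_big => x; rewrite ?inE // => _; rewrite -cards_draws.
  apply: eq_card => A; rewrite !inE subsetI.
  by rewrite -andbA andbC.
rewrite (sum_card_set _ _ (fun x (A : {set T}) => A \subset nbr E x)) -(cards_draws W l) mulnC -sum_nat_const.
apply: leq_sum => A; rewrite inE => /andP[_ /eqP /freeE].
have -> : [set i in setT | A \subset nbr E i] = [set x | A \subset nbr E x].
  by apply/setP => x; rewrite !inE.
by lia.
Qed.

(** [D'] lives on vertices that are unmatched or freed by removing [D], so it cannot touch the edges
    of [M] that stay. *)
Lemma matching_exchange (T : finType) (M D D' : {set {set T}}) :
    simple M -> trivIset M -> D \subset M -> simple D' -> trivIset D' ->
    cover D' \subset cover D :|: ~: cover M ->
  trivIset (D' :|: (M :\: D)) /\ #|D' :|: (M :\: D)| = #|D'| + (#|M| - #|D|).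
Proof.
move=> sM tM DM sD' tD' covD'.
have disj : [disjoint cover D' & cover (M :\: D)].
  rewrite disjoint_subset; apply/subsetP => x /(subsetP covD').
  rewrite !inE => /orP[/bigcupP[d dD xd]|]; last first.
    apply: contra => /bigcupP[e]; rewrite inE => /andP[_ eM] xe.
    by apply/bigcupP; exists e.
  apply/negP => /bigcupP[e]; rewrite inE => /andP[eD eM] xe.
  have /(trivIsetP tM) : e \in M by [].
  move=> /(_ d (subsetP DM _ dD)); case: eqP => [ed|_ /(_ isT)].
    by rewrite ed dD in eD.
  by move/disjointFr/(_ xe); rewrite xd.
split; first by apply: trivIsetU => //; apply: trivIsetD.
suff disjD : D' :&: (M :\: D) = set0.
  by rewrite cardsU disjD cards0 subn0 cardsD (setIidPr DM).
apply/setP => e; rewrite inE in_set0; apply/negP => /andP[eD' eM].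
have /set0Pn[x xe] : e != set0 by rewrite -card_gt0 sD'.
have /(disjointFr disj)/negP[] : x \in cover D' by apply/bigcupP; exists e.
by apply/bigcupP; exists e.
Qed.

Lemma matching2 (T : finType) (e f : {set T}) :
    #|e| = 2 -> #|f| = 2 -> [disjoint e & f] ->
  [/\ simple [set e; f], trivIset [set e; f] & #|[set e; f]| = 2].
Proof.
move=> ce cf ef; split; first by move=> g /set2P[]->.
  have [] // := @trivIsetU1 _ e [set f] _ (trivIset1 f).
    by move=> g /set1P ->.
  by rewrite inE eq_sym -cards_eq0 cf.
rewrite cards2; case: eqP => // eqef; move: ef.
by rewrite -setI_eq0 -eqef setIid -cards_eq0 ce.
Qed.

Lemma matching3 (T : finType) (e f g : {set T}) :
    #|e| = 2 -> #|f| = 2 -> #|g| = 2 ->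
    [disjoint e & f] -> [disjoint e & g] -> [disjoint f & g] ->
  [/\ simple (e |: [set f; g]), trivIset (e |: [set f; g]) &
      #|e |: [set f; g]| = 3].
Proof.
move=> ce cf cg ef eg fg; have [sfg tfg cfg] := matching2 cf cg fg.
have [||tefg eNfg] := @trivIsetU1 _ e _ _ tfg.
- by move=> h /set2P[]->; [apply: ef | apply: eg].
- by rewrite !inE !(eq_sym set0) -!cards_eq0 cf cg.
by split=> [h /setU1P[->|/sfg] //||]; rewrite // cardsU1 eNfg cfg.
Qed.

Lemma disjoint_set2 (T : finType) (a b c d : T) :
  [disjoint [set a; b] & [set c; d]] = [&& a != c, a != d, b != c & b != d].
Proof. by rewrite disjoints_subset subUset !sub1set !inE !negb_or -!andbA. Qed.

Lemma mem_cover (T : finType) (D : {set {set T}}) (e : {set T}) (x : T) :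
  e \in D -> x \in e -> x \in cover D.
Proof. by move=> eD xe; apply/bigcupP; exists e. Qed.

Lemma exists_other (T : finType) (A : {set T}) (z : T) :
  1 < #|A| -> exists2 y, y \in A & y != z.
Proof.
rewrite (cardsD1 z) => ltA; have /set0Pn[y] : A :\ z != set0.
  by rewrite -card_gt0; case: (z \in A) ltA => //; lia.
by rewrite !inE => /andP[]; exists y.
Qed.

(** * Maximum matchings and heavy vertices *)

Definition max_matching (T : finType) (E M : {set {set T}}) : Prop :=
  [/\ M \subset E, trivIset M &
      forall M' : {set {set T}}, M' \subset E -> trivIset M' -> #|M'| <= #|M|].

Lemma exists_max_matching (T : finType) (E : {set {set T}}) :
  exists M, max_matching E M.
Proof.
pose P (M : {set {set T}}) := (M \subset E) && trivIset M.
have P0 : P set0.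
  by rewrite /P sub0set; apply/trivIsetP => A B; rewrite inE.
exists [arg max_(M > set0 | P M) #|M|].
case: arg_maxnP => // M /andP[ME tM] maxM; split=> // M' M'E tM'.
by apply: maxM; rewrite /P M'E.
Qed.

(** Two unmatched neighbours leave a choice even when one vertex must be avoided, as in the
    exchanges below. *)
Definition heavy (T : finType) (E M : {set {set T}}) : {set T} :=
  [set x in cover M | 1 < #|nbr E x :&: ~: cover M|].

Lemma max_matching_exchange (T : finType) (E M D D' : {set {set T}}) :
    simple E -> max_matching E M -> D \subset M -> D' \subset E -> trivIset D' ->
    {in D', forall e : {set T}, e \subset cover D :|: ~: cover M} ->
  #|D'| <= #|D|.
Proof.
move=> sE [ME tM maxM] DM D'E tD' covD'.
have [|||tM' cM'] := matching_exchange _ tM DM _ tD'.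
- by move=> e /(subsetP ME)/sE.
- by move=> e /(subsetP D'E)/sE.
- by apply/bigcupsP.
have /maxM/(_ tM') : D' :|: (M :\: D) \subset E.
  by rewrite subUset D'E (subset_trans (subsetDl _ _) ME).
by rewrite cM'; have := subset_leq_card DM; lia.
Qed.

Lemma max_matching_cover (T : finType) (E M : {set {set T}}) (x y : T) :
  simple E -> max_matching E M -> [set x; y] \in E ->
  (x \in cover M) || (y \in cover M).
Proof.
move=> sE maxM xyE; rewrite -[_ || _]negbK negb_or; apply/negP => /andP[xM yM].
have := @max_matching_exchange _ E M set0 [set [set x; y]] sE maxM.
rewrite sub0set sub1set xyE trivIset1 cards1 cards0 => H.
have // := H isT isT isT _ => {}H; suff: 0 < 0 by [].
apply: H => e /set1P->; rewrite subUset !sub1set !inE (negPf xM) (negPf yM) !orbT //.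
Qed.

(** If both ends [x], [y] of [e] were heavy, trading [e] for [xz] and [yw] with distinct unmatched
    [z], [w] would enlarge [M]. *)
Lemma max_matching_heavy (T : finType) (E M : {set {set T}}) (e : {set T}) :
  simple E -> max_matching E M -> e \in M -> #|e :&: heavy E M| <= 1.
Proof.
move=> sE maxM eM; have [ME _ _] := maxM.
rewrite leqNgt; apply/negP => heavy2.
have ce := sE _ (subsetP ME _ eM).
have /setIidPl/subsetP eH : e :&: heavy E M = e.
  by apply/eqP; rewrite eqEcard subsetIl ce.
have /cards2P[x [y [xy def_e]]] : #|e| == 2 by rewrite ce.
have xH : x \in heavy E M by apply: eH; rewrite def_e !inE eqxx.
have yH : y \in heavy E M by apply: eH; rewrite def_e !inE eqxx orbT.
move: xH yH; rewrite [x \in _]inE [y \in _]inE => /andP[xM xI] /andP[yM yI].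
have [z zI _] := exists_other x xI; have [w wI wz] := exists_other z yI.
move: zI wI; rewrite !in_setI !in_setC !in_set => /andP[xzE zM] /andP[ywE wM].
have neqM a b : a \in cover M -> b \notin cover M -> a != b.
  by move=> aM; apply: contraNneq => <-.
have [|_ tD' cD'] := matching2 (sE _ xzE) (sE _ ywE).
  by rewrite disjoint_set2 xy (eq_sym z w) wz (eq_sym z) !neqM.
have := @max_matching_exchange _ E M [set e] [set [set x; z]; [set y; w]] sE maxM.
rewrite cD' cards1 sub1set eM tD' subUset !sub1set xzE ywE => H.
suff: 1 < 1 by []; apply: H => // f /set2P[]->.
  by rewrite subUset !sub1set !in_setU !in_setC zM (mem_cover (set11 e)) ?orbT // def_e !inE eqxx.
by rewrite subUset !sub1set !in_setU !in_setC wM (mem_cover (set11 e)) ?orbT // def_e !inE eqxx orbT.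
Qed.

Lemma card_sum_matching (T : finType) (M : {set {set T}}) (H : {set T}) :
  trivIset M -> H \subset cover M -> #|H| = \sum_(e in M) #|e :&: H|.
Proof.
move=> tM /setIidPr HM; rewrite -[in LHS]HM -sum1_card.
under eq_bigl do rewrite inE; rewrite big_trivIset_cond //=.
by apply: eq_bigr => e _; rewrite -sum1_card; apply: eq_bigl => x; rewrite inE.
Qed.

Lemma card_heavy (T : finType) (E M : {set {set T}}) :
  simple E -> max_matching E M -> #|heavy E M| <= #|M|.
Proof.
move=> sE maxM; have [_ tM _] := maxM.
rewrite (card_sum_matching tM); last by apply/subsetP => x; rewrite inE => /andP[].
by rewrite -sum1_card; apply: leq_sum => e; apply: max_matching_heavy.
Qed.

(** Each edge of [M] holds at most one heavy vertex, so an edge without any would leave fewer than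
    [#|M|] of them. *)
Lemma heavy_meets (T : finType) (E M : {set {set T}}) (e : {set T}) :
    simple E -> max_matching E M -> #|heavy E M| = #|M| -> e \in M ->
  e :&: heavy E M != set0.
Proof.
move=> sE maxM cH eM; have [_ tM _] := maxM; apply/negP => /eqP e0.
have : #|heavy E M| <= \sum_(f in M | f != e) 1.
  rewrite {1}(card_sum_matching tM); last by apply/subsetP => x; rewrite inE => /andP[].
  rewrite (bigD1 e) //= e0 cards0; apply: leq_sum => f /andP[fM _].
  exact: max_matching_heavy.
have := sum1_card (mem M); rewrite (bigD1 e) //=.
by rewrite cH => <-; rewrite add1n ltnn.
Qed.

(* An edge missing the heavy vertices lies in an alternating path whose ends are
   heavy vertices, and these reach distinct unmatched vertices. *)
Lemma heavy_cover (T : finType) (E M : {set {set T}}) (u v : T) :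
    simple E -> max_matching E M -> #|heavy E M| = #|M| -> [set u; v] \in E ->
  (u \in heavy E M) || (v \in heavy E M).
Proof.
move=> sE maxM cH; have [ME tM _] := maxM.
have neqM a b : a \in cover M -> b \notin cover M -> a != b.
  by move=> aM; apply: contraNneq => <-.
have partner a : a \in cover M -> a \notin heavy E M ->
    exists b, [/\ a != b, [set a; b] \in M & b \in heavy E M].
  case/bigcupP => e eM ae aH.
  have [b ab def_e] := edge_other_end (sE _ (subsetP ME _ eM)) ae.
  exists b; split=> //; first by rewrite -def_e.
  have /set0Pn[c] := heavy_meets sE maxM cH eM.
  by rewrite def_e in_setI in_set2 => /andP[/orP[]/eqP->] //; rewrite (negPf aH).
wlog uM : u v / u \in cover M.
  move=> WL uvE; have /orP[uM|vM] := max_matching_cover sE maxM uvE; first exact: WL.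
  by rewrite orbC; apply: WL => //; rewrite setUC.
move=> uvE; rewrite -[_ || _]negbK negb_or; apply/negP => /andP[uH vH].
have uv := simple_neq sE uvE.
have [x [ux uxM xH]] := partner u uM uH.
have := xH; rewrite [x \in _]inE => /andP[xM xI].
(* With [v] unmatched the path is [z x u v]: its middle edge [ux] is traded for [xz] and [uv]. *)
have [vM|vM] := boolP (v \in cover M); last first.
  have [z zI zv] := exists_other v xI.
  move: zI; rewrite !in_setI !in_setC !in_set => /andP[xzE zM].
  have [|_ tD' cD'] := matching2 (sE _ xzE) (sE _ uvE).
    by rewrite disjoint_set2 zv (eq_sym x u) ux (eq_sym z u) !neqM.
  have := @max_matching_exchange _ E M [set [set u; x]] [set [set x; z]; [set u; v]] sE maxM.
  rewrite cD' cards1 sub1set uxM tD' subUset !sub1set xzE uvE => H.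
  suff: 1 < 1 by []; apply: H => // f /set2P[]->.
    by rewrite subUset !sub1set !in_setU !in_setC zM (mem_cover (set11 _)) ?orbT // !inE eqxx orbT.
  by rewrite subUset !sub1set !in_setU !in_setC vM (mem_cover (set11 _)) ?orbT // !inE eqxx.
(* Now the path is [z x u v y w]: the matching edges [ux], [vy] are traded for [xz], [uv], [yw]. *)
have [y [vy vyM yH]] := partner v vM vH.
have := yH; rewrite [y \in _]inE => /andP[yM yI].
have neq_uxvy : [set u; x] != [set v; y].
  apply/eqP => /setP/(_ v); rewrite !inE eqxx /= eq_sym (negPf uv) /= => /eqP vx.
  by rewrite vx xH in vH.
have := trivIsetP tM _ _ uxM vyM neq_uxvy.
rewrite disjoint_set2 => /and4P[_ uy xv xy].
have [z zI _] := exists_other x xI; have [w wI wz] := exists_other z yI.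
move: zI wI; rewrite !in_setI !in_setC !in_set => /andP[xzE zM] /andP[ywE wM].
have [| | |_ tD' cD'] := matching3 (sE _ uvE) (sE _ xzE) (sE _ ywE).
- by rewrite disjoint_set2 ux (eq_sym v x) xv !neqM.
- by rewrite disjoint_set2 uy vy !neqM.
- by rewrite disjoint_set2 xy (eq_sym z w) wz (eq_sym z) !neqM.
have [|_ _ cD] := matching2 (sE _ (subsetP ME _ uxM)) (sE _ (subsetP ME _ vyM)).
  exact: (trivIsetP tM).
have := @max_matching_exchange _ E M [set [set u; x]; [set v; y]] _ sE maxM _ _ tD'.
rewrite cD' cD !subUset !sub1set uxM vyM xzE ywE uvE => H.
have ux2 := set21 [set u; x] [set v; y]; have vy2 := set22 [set u; x] [set v; y].
suff: 2 < 2 by []; apply: H => // f /setU1P[->|/set2P[]->].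
- by rewrite subUset !sub1set !in_setU (mem_cover ux2) ?(mem_cover vy2) // !inE eqxx.
- by rewrite subUset !sub1set !in_setU !in_setC zM (mem_cover ux2) ?orbT // !inE eqxx orbT.
- by rewrite subUset !sub1set !in_setU !in_setC wM (mem_cover vy2) ?orbT // !inE eqxx orbT.
Qed.

(** * Upper bound *)

(** From [d = l - 1] on, each unit step in [d] adds at least one to ['C(d, l)]. Equality holds at
    [d = l - 1] and [d = l], the degrees of the extremal graph outside [S]. *)
Lemma leq_add_bin (l d : nat) : 0 < l -> d <= (l - 1) + 'C(d, l).
Proof.
case: l => // l _; rewrite subn1 /=; elim: d => [//|d IH].
have [ltd|led] := ltnP d l; first by lia.
have C0 : 0 < 'C(d, l) by rewrite bin_gt0.
by rewrite binS; lia.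
Qed.

(** Binomial coefficients grow up to the middle. With [k = l - 1] this makes the star loss at least
    quadratic in [s]. *)
Lemma leq_bin2 (m k : nat) : 2 <= k -> 2 * k <= m -> 'C(m, 2) <= 'C(m, k).
Proof.
elim: k => // k IH; rewrite leq_eqVlt => /orP[/eqP<- //|k2] km.
apply: leq_trans (IH _ _) _; [lia|lia|].
rewrite -(leq_pmul2l (ltn0Sn k)) mul_bin_left leq_mul2r.
by apply/orP; right; lia.
Qed.

Lemma ffact_leq_exp (n m : nat) : n ^_ m <= n ^ m.
Proof.
by elim: m => // m IH; rewrite ffactnSr expnSr leq_mul // leq_subr.
Qed.

Lemma exp_leq_ffact (n m : nat) : (n.+1 - m) ^ m <= n ^_ m.
Proof.
elim: m => // m IH; rewrite subSS ffactnSr expnSr leq_mul2r; apply/orP; right.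
by apply: leq_trans IH; case: m => // m; rewrite leq_exp2r; lia.
Qed.

(** After multiplying by the factorial of [l], the left side is at most [(2s)^l], while each factor
    of the falling factorial of [s %/ 2] exceeds [s / 4]. *)
Lemma bin_double_half (s l : nat) : 4 * l <= s -> 'C(2 * s, l) <= 8 ^ l * 'C(s %/ 2, l).
Proof.
move=> ls; rewrite -(leq_pmul2r (fact_gt0 l)) -mulnA !bin_ffact.
apply: leq_trans (ffact_leq_exp _ _) _.
apply: leq_trans (leq_mul (leqnn _) (exp_leq_ffact _ _)).
by rewrite -expnMn; case: l ls => // l ls; rewrite leq_exp2r; lia.
Qed.

(* The bound needs a leading constant below 2; no convexity argument is required
   for that, only that boundedly many vertices have more than [s / 2] neighbours
   in [W]. *)
Lemma sum_nbr_Klt_free (T : finType) (l t s : nat) (E : {set {set T}}) (W : {set T}) :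
    Klt_free l t E -> 4 * l <= s -> #|W| <= 2 * s ->
  \sum_(x in W) #|nbr E x :&: W| <= s ^ 2 + 2 * (t - 1) * 8 ^ l * s.
Proof.
move=> freeE ls cW; pose B := [set x | s %/ 2 < #|nbr E x :&: W|].
(* A vertex of [B] centres at least ['C(s %/ 2, l)] stars in [W], so the star count bounds [#|B|]
   independently of [s]. *)
have cB : #|B| <= (t - 1) * 8 ^ l.
  have C0 : 0 < 'C(s %/ 2, l) by rewrite bin_gt0; lia.
  rewrite -(leq_pmul2r C0) -mulnA.
  apply: leq_trans (leq_mul (leqnn _) (bin_double_half ls)).
  apply: leq_trans (leq_mul (leqnn _) (leq_bin2l _ cW)).
  apply: leq_trans (sum_bin_nbr W freeE); rewrite -sum_nat_const.
  apply: leq_trans (_ : \sum_(x in B) 'C(#|nbr E x :&: W|, l) <= _).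
    by apply: leq_sum => x; rewrite inE => /ltnW; apply: leq_bin2l.
  by rewrite [leqRHS](bigID [in B]) /= leq_addr.
(* The main term [s ^ 2] is [2 * s] vertices times [s / 2]; the extra charge on [B] is only linear
   in [s]. *)
apply: leq_trans (_ : \sum_(x in W) (s %/ 2 + (x \in B) * (2 * s)) <= _).
  apply: leq_sum => x _; rewrite inE; case: ltnP => [_|]; last by lia.
  by have := subset_leq_card (subsetIr (nbr E x) W); lia.
rewrite big_split sum_nat_const -big_distrl /=.
have -> : \sum_(x in W) (x \in B) = #|W :&: B|.
  by rewrite -sum1_card -big_mkcondr /=; apply: eq_bigl => x; rewrite [RHS]in_setI.
have := subset_leq_card (subsetIr W B) => cWB.
have h1 : #|W| * (s %/ 2) <= 2 * s * (s %/ 2) by rewrite leq_mul2r cW orbT.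
have h2 : #|W :&: B| * (2 * s) <= (t - 1) * 8 ^ l * (2 * s).
  by rewrite leq_mul2r (leq_trans cWB cB) orbT.
have h3 : s * (2 * (s %/ 2)) <= s * s by rewrite leq_mul2l; apply/orP; right; lia.
by lia.
Qed.

(** Degrees into [S] have weight 1 on [S] and weight 2 outside; the smaller weight saves
    [#|S| * (l - 1)], and one star count serves both sums. *)
Lemma edges_cover (T : finType) (l t : nat) (E : {set {set T}}) (S : {set T}) :
    simple E -> Klt_free l t E -> 0 < l ->
    (forall x y, [set x; y] \in E -> (x \in S) || (y \in S)) ->
  2 * #|E| + #|S| * (l - 1) <= 2 * ((l - 1) * #|T| + (t - 1) * 'C(#|S|, l)).
Proof.
move=> sE freeE l0 covS; rewrite (sum_nbr_cover sE covS).
have := sum_bin_nbr S freeE; rewrite (bigID [in S]) /=.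
have h1 : \sum_(x in S) #|nbr E x :&: S| <=
    \sum_(x in S) ((l - 1) + 'C(#|nbr E x :&: S|, l)).
  by apply: leq_sum => x _; apply: leq_add_bin.
have h2 : \sum_(x in ~: S) #|nbr E x :&: S| <=
    \sum_(x in ~: S) ((l - 1) + 'C(#|nbr E x :&: S|, l)).
  by apply: leq_sum => x _; apply: leq_add_bin.
rewrite !big_split !sum_nat_const /= in h1 h2.
have -> : \sum_(x | x \notin S) 'C(#|nbr E x :&: S|, l) =
    \sum_(x in ~: S) 'C(#|nbr E x :&: S|, l).
  by apply: eq_bigl => x; rewrite inE.
have := cardsC S; rewrite -/#|T| => <-.
by rewrite mulnDr; lia.
Qed.

(** Edges are split along the cover [W] of [M]: those inside [W]; those leaving non-heavy vertices,
    at most one each, whence [4 * s] after doubling; and those leaving the at most [s - 1] heavy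
    vertices, bounded by stars. *)
Lemma edges_few_heavy (T : finType) (l t s : nat) (E M : {set {set T}}) :
    simple E -> Klt_free l t E -> 0 < l -> 4 * l <= s -> max_matching E M ->
    #|M| <= s -> #|heavy E M| < s ->
  2 * #|E| <= s ^ 2 + 2 * (t - 1) * 8 ^ l * s + 4 * s
              + 2 * ((l - 1) * #|T| + (t - 1) * 'C(s - 1, l)).
Proof.
move=> sE freeE l0 ls maxM cM cH; have [ME tM _] := maxM.
pose W := cover M; pose H := heavy E M.
have cW : #|W| <= 2 * s.
  rewrite (leq_trans (leq_card_cover M)) //.
  rewrite (eq_bigr (fun=> 2)); last by move=> e /(subsetP ME)/sE.
  by rewrite sum_nat_const mulnC leq_mul2l cM orbT.
rewrite (@sum_nbr_cover _ E W sE); last by move=> x y; apply: max_matching_cover.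
have := sum_nbr_Klt_free freeE ls cW.
suff : \sum_(x in ~: W) #|nbr E x :&: W| <= 2 * s + ((l - 1) * #|T| + (t - 1) * 'C(s - 1, l)).
  by lia.
have HW : H \subset W by apply/subsetP => x; rewrite inE => /andP[].
rewrite sum_nbr_swap (big_setID H) (setIidPr HW) /= addnC leq_add //.
  apply: leq_trans cW; rewrite -sum1_card.
  apply: leq_trans (_ : \sum_(x in W :\: H) 1 <= _); last first.
    by rewrite !sum1_card subset_leq_card // subsetDl.
  by apply: leq_sum => x; rewrite !inE => /andP[xH xW]; rewrite xW -leqNgt in xH.
(* The heavy part is summed over the unmatched vertices again, since the star count needs degrees
   into [H]. *)
rewrite sum_nbr_swap.
apply: leq_trans (_ : \sum_(x in ~: W) ((l - 1) + 'C(#|nbr E x :&: H|, l)) <= _).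
  by apply: leq_sum => x _; apply: leq_add_bin.
rewrite big_split sum_nat_const /= leq_add //.
  by rewrite mulnC leq_mul2l max_card orbT.
apply: leq_trans (_ : (t - 1) * 'C(#|H|, l) <= _); last first.
  by rewrite leq_mul2l leq_bin2l ?orbT // /H; lia.
apply: leq_trans (sum_bin_nbr H freeE).
by rewrite [leqRHS](bigID [in ~: W]) /= leq_addr.
Qed.

(** Stated doubled, so that rounding is postponed to the end. *)
Lemma edges_upper (T : finType) (l t s : nat) (E : {set {set T}}) :
    3 <= l <= t -> 8 * l + 2 * (t - 1) * 8 ^ l + 20 <= s ->
    simple E -> Klt_free l t E ->
    (forall M : {set {set T}}, M \subset E -> trivIset M -> #|M| <= s) ->
  2 * #|E| + s * (l - 1) <= 2 * ((l - 1) * #|T| + (t - 1) * 'C(s, l)).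
Proof.
move=> /andP[l3 lt] ls sE freeE noM.
have [M maxM] := exists_max_matching E; have [ME tM _] := maxM.
have cM := noM M ME tM; have cHM := card_heavy sE maxM.
have [cH|cH] := ltnP #|heavy E M| s; last first.
  (* Both [#|heavy E M|] and [#|M|] are squeezed to [s], so the heavy vertices form a cover. *)
  have cHs : #|heavy E M| = s by lia.
  have := @edges_cover _ l t E (heavy E M) sE freeE.
  rewrite cHs; apply; first by lia.
  by move=> x y; apply: heavy_cover => //; lia.
have ls8 : 8 * l + 20 <= s by apply: leq_trans ls; rewrite leq_add2r leq_addr.
have l0 : 0 < l by lia.
have l4 : 4 * l <= s by lia.
have := edges_few_heavy sE freeE l0 l4 maxM cM cH.
have [k def_l] : exists k, l = k.+1 by exists l.-1; lia.
have [r def_s] : exists r, s = r.+1 by exists s.-1; lia.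
have -> : s - 1 = r by lia.
(* By Pascal's rule, one heavy vertex fewer costs [(t - 1) * 'C(r, l - 1)]; this is at least
   [(r - 1) * r], as [t - 1] and [l - 1] are at least 2. *)
have -> : 'C(s, l) = 'C(r, l) + 'C(r, l - 1) by rewrite def_s def_l subn1 binS.
have C2 : 2 * 'C(r, 2) = (r - 1) * r by rewrite mul_bin_left bin1.
have h1 : 2 * 'C(r, 2) <= (t - 1) * 'C(r, l - 1).
  by apply: leq_mul; [lia | apply: leq_bin2; lia].
have h2 : (8 * l + 2 * (t - 1) * 8 ^ l + 20) * s <= s * s by rewrite leq_mul2r ls orbT.
have h3 : (r - 1) * r + 3 * s = s * s + 2 by rewrite def_s; nia.
rewrite C2 in h1.
(* The right side is at least [2 * s ^ 2 - 6 * s]; the surplus [s ^ 2] absorbs the linear terms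
   because [s] is large. *)
suff : s ^ 2 + 2 * (t - 1) * 8 ^ l * s + 4 * s + s * (l - 1) <= 2 * ((t - 1) * 'C(r, l - 1)).
  by rewrite !mulnDr; lia.
have : s * (l - 1) <= l * s by rewrite mulnC leq_mul2r leq_subr orbT.
rewrite !mulnDl in h2.
by rewrite -mulnn; lia.
Qed.

(** * Nearly regular graphs *)

Lemma card_incidentU1 (T : finType) (F : {set {set T}}) (e : {set T}) (w : T) :
  #|incident (e |: F) w| <= (w \in e) + #|incident F w|.
Proof.
have [we|we] := boolP (w \in e).
  apply: leq_trans (_ : #|e |: incident F w| <= _).
    apply: subset_leq_card; apply/subsetP => f; rewrite !inE.
    by case: (f == e) => //= ->.
  by rewrite cardsU1 leq_add2r; case: (_ \notin _).
apply: subset_leq_card; apply/subsetP => f; rewrite !inE.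
by case: eqP => //= ->; rewrite (negPf we) andbF.
Qed.

Lemma card_incidentD1 (T : finType) (F : {set {set T}}) (e : {set T}) (w : T) :
  e \in F -> #|incident F w| = (w \in e) + #|incident (F :\ e) w|.
Proof.
move=> eF; rewrite (cardsD1 e) inE eF /=; congr (_ + _).
by apply: eq_card => f; rewrite !inE andbA.
Qed.

(** Boolean, so that a graph with the most edges can be chosen by [arg max]. *)
Definition deg_graph_on (T : finType) (S : {set T}) (d : nat) (F : {set {set T}}) : bool :=
  [forall e in F, (#|e| == 2) && (e \subset S)] && [forall x, #|incident F x| <= d].

Lemma deg_graph_onP (T : finType) (S : {set T}) (d : nat) (F : {set {set T}}) :
  reflect [/\ simple F, {in F, forall e : {set T}, e \subset S} &
              forall x, #|incident F x| <= d]
          (deg_graph_on S d F).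
Proof.
apply: (iffP andP) => [[/forall_inP FS /forallP dF]|[sF FS dF]].
  by split=> // e /FS/andP[/eqP].
by split; [apply/forall_inP => e eF; rewrite sF // FS | apply/forallP].
Qed.

Lemma sum_incident_on (T : finType) (S : {set T}) (F : {set {set T}}) :
  simple F -> {in F, forall e : {set T}, e \subset S} ->
  \sum_(x in S) #|incident F x| = 2 * #|F|.
Proof.
move=> sF FS; rewrite (sum_card_set S F (fun x e => x \in e)) mulnC -sum_nat_const.
apply: eq_bigr => e eF; rewrite -(sF e eF); apply: eq_card => x; rewrite inE andb_idl //.
exact: (subsetP (FS e eF)).
Qed.

(* If the total degree defect were at least 2, carried by [u] and [v], then
   trading an edge [xy] far from both for [ux] and [vy] would gain an edge. *)
Lemma exists_near_regular (T : finType) (S : {set T}) (d : nat) :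
    0 < d -> 4 * d.+1 * d + 2 <= #|S| ->
  exists F, [/\ simple F, {in F, forall e : {set T}, e \subset S},
                forall x, #|incident F x| <= d & d * #|S| <= 2 * #|F| + 1].
Proof.
move=> d0 cS; pose P := deg_graph_on S d.
have P0 : P set0.
  apply/deg_graph_onP; split=> [e|e|x]; rewrite ?inE //.
  by rewrite (_ : incident _ _ = set0) ?cards0 //; apply/setP => e; rewrite !inE.
have [F [/deg_graph_onP[sF FS dF] maxF]] :
    exists F, P F /\ forall F', P F' -> #|F'| <= #|F|.
  by exists [arg max_(F > set0 | P F) #|F|]; case: arg_maxnP.
exists F; split=> //; rewrite leqNgt; apply/negP => defect.
have sumF := sum_incident_on sF FS.
(* [u = v] is allowed, for a single vertex of defect at least 2; adding the two indicators treats
   both cases alike. *)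
have [u [v [uS vS duv]]] : exists u v, [/\ u \in S, v \in S &
    forall w, #|incident F w| + (w == u) + (w == v) <= d].
  have [u uS du] : exists2 u, u \in S & #|incident F u| < d.
    apply/exists_inP; apply: contraLR defect; rewrite negb_exists_in => /forall_inP dS.
    rewrite -leqNgt -sumF mulnC -sum_nat_const.
    by apply: leq_trans (leq_addr _ _); apply: leq_sum => x /dS; rewrite -leqNgt.
  have [du2|du2] := ltnP (#|incident F u|).+1 d.
    by exists u, u; split=> // w; have := dF w; case: eqP => [->|]; lia.
  have [v /andP[vS vu] dv] : exists2 v, (v \in S) && (v != u) & #|incident F v| < d.
    apply/exists_inP; apply: contraLR defect; rewrite negb_exists_in => /forall_inP dS.
    rewrite -leqNgt -sumF mulnC -sum_nat_const (bigD1 u) //= [X in _ <= X + 1](bigD1 u) //=.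
    have : \sum_(i in S | i != u) d <= \sum_(i in S | i != u) #|incident F i|.
      by apply: leq_sum => x /dS; rewrite -leqNgt.
    by move=> /(leq_add du2)/leq_trans-> //; rewrite addSn addn1.
  exists u, v; split=> // w; have := dF w.
  case: (eqVneq w u) => [->|_]; first by rewrite [u == v]eq_sym (negPf vu); lia.
  by case: (eqVneq w v) => [->|_]; lia.
have [x [y [xyF nx ny uxF vyF]]] : exists x y, [/\ [set x; y] \in F, x \notin [set u; v],
    y \notin [set u; v], [set u; x] \notin F & [set v; y] \notin F].
  pose Z := [set u; v] :|: nbr F u :|: nbr F v.
  have cZ : #|Z| <= 2 * d.+1.
    have := dF u; have := dF v; rewrite !card_incident //.
    have := cardsU ([set u; v] :|: nbr F u) (nbr F v).
    have := cardsU [set u; v] (nbr F u).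
    by have := cards2 u v; rewrite /Z; case: (u != v); lia.
  have [/existsP[e /andP[eF eZ]]|] := boolP [exists e, (e \in F) && [disjoint e & Z]].
    have /eqP/cards2P[x [y [_ def_e]]] := sF e eF.
    have [xZ yZ] : x \notin Z /\ y \notin Z.
      by split; rewrite (disjointFr eZ) // def_e !inE eqxx ?orbT.
    move: xZ yZ; rewrite !in_setU !negb_or.
    rewrite !in_set1 !in_set -!andbA => /and4P[? ? ux ?] /and4P[? ? ? vy].
    by exists x, y; rewrite -def_e !in_set2 !negb_or; split=> //; apply/andP.
  (* If every edge meets [Z], then [F] is so small that [S] has two isolated vertices, and joining
     them contradicts maximality. *)
  move=> noe; exfalso.
  have cF : #|F| <= 2 * d.+1 * d.
    apply: leq_trans (_ : \sum_(z in Z) #|incident F z| <= _); last first.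
      apply: leq_trans (_ : \sum_(z in Z) d <= _); first exact: leq_sum.
      by rewrite sum_nat_const leq_mul2r cZ orbT.
    rewrite (sum_card_set Z F (fun x e => x \in e)) -sum1_card; apply: leq_sum => e eF.
    rewrite card_gt0; move: noe; rewrite negb_exists => /forallP/(_ e).
    rewrite eF /= -setI_eq0 => /set0Pn[z]; rewrite inE => /andP[ze zZ].
    by apply/set0Pn; exists z; rewrite inE zZ.
  pose S0 := [set x in S | #|incident F x| == 0].
  have : #|S :\: S0| <= 2 * #|F|.
    rewrite -sumF (big_setID S0) /= -sum1_card; apply: leq_trans (leq_addl _ _).
    by apply: leq_sum => x; rewrite !inE => /andP[+ xS]; rewrite xS lt0n.
  have /setIidPr S0S : S0 \subset S by apply/subsetP => x; rewrite inE => /andP[].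
  have := cardsID S0 S; rewrite S0S => cS0 cSS0.
  have : 1 < #|S0| by lia.
  case/card_gt1P => x [y [xS0 yS0 xy]].
  move: xS0 yS0; rewrite [x \in _]inE [y \in _]inE => /andP[xS /eqP x0] /andP[yS /eqP y0].
  have xyF : [set x; y] \notin F.
    apply/negP => xyF; move/eqP: x0; rewrite cards_eq0 => /eqP/setP/(_ [set x; y]).
    by rewrite !inE xyF eqxx.
  suff /maxF : P ([set x; y] |: F) by rewrite cardsU1 xyF ltnn.
  apply/deg_graph_onP; split=> [e /setU1P[->|/sF]//|e /setU1P[->|/FS]//|w].
  - by rewrite cards2 xy.
  - by rewrite subUset !sub1set xS.
  apply: leq_trans (card_incidentU1 _ _ _) _; rewrite !inE.
  have [->|_] := eqVneq w x; first by rewrite x0.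
  have [->|_] := eqVneq w y; first by rewrite y0.
  exact: dF.
have [F1 def_F1] : exists F1, F1 = [set v; y] |: (F :\ [set x; y]) by eexists.
have xy := simple_neq sF xyF.
have /andP[xS yS] : (x \in S) && (y \in S) by have := FS _ xyF; rewrite subUset !sub1set.
have xuv : (x != u) && (x != v) by move: nx; rewrite !inE negb_or.
have yuv : (y != u) && (y != v) by move: ny; rewrite !inE negb_or.
have cF1 : #|F1| = #|F|.
  by rewrite def_F1 cardsU1 !inE (negPf vyF) andbF [RHS](cardsD1 [set x; y]) xyF.
have uxF1 : [set u; x] \notin F1.
  rewrite def_F1 !inE (negPf uxF) andbF orbF; apply/eqP => /setP/(_ x).
  by rewrite !inE eqxx orbT (negPf xy) orbF => /esym; case/andP: xuv => _ /negPf ->.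
suff /maxF : P ([set u; x] |: F1) by rewrite cardsU1 uxF1 cF1 ltnn.
apply/deg_graph_onP; split=> [e|e|w].
- rewrite def_F1 => /setU1P[->|/setU1P[->|/setD1P[_ /sF]]//]; rewrite cards2 eq_sym.
    by case/andP: xuv => ->.
  by case/andP: yuv => _ ->.
- rewrite def_F1 => /setU1P[->|/setU1P[->|/setD1P[_ /FS]]//]; rewrite subUset !sub1set.
    by rewrite uS.
  by rewrite vS.
apply: leq_trans (card_incidentU1 _ _ _) _; rewrite def_F1.
apply: leq_trans (leq_add (leqnn _) (card_incidentU1 _ _ _)) _.
(* Removing [xy] offsets the new edges at [x] and [y], and [duv] leaves room at [u] and [v]. *)
apply: leq_trans (duv w); rewrite (card_incidentD1 w xyF) !inE.
have : ~~ ((w == x) && (w == y)).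
  by apply: contra xy => /andP[/eqP<- /eqP<-].
by move: (w == x) (w == y) (w == u) (w == v) #|_| => [] [] [] [] k //= _; clear -k; lia.
Qed.

(** * The extremal graph *)

Lemma exists_subset_card (T : finType) (S : {set T}) (k : nat) :
  k <= #|S| -> exists2 A : {set T}, A \subset S & #|A| = k.
Proof.
rewrite -bin_gt0 -cards_draws card_gt0 => /set0Pn[A].
by rewrite inE => /andP[AS /eqP cA]; exists A.
Qed.

(** The vertices outside [S] are listed and cut into blocks of length [q], one per [l]-subset of
    [S]; the remaining ones all get the [(l - 1)]-subset [A0]. *)
Lemma exists_attachment (T : finType) (S : {set T}) (l q : nat) :
    0 < l <= #|S| -> #|S| + q * 'C(#|S|, l) <= #|T| ->
  exists att : T -> {set T},
    [/\ forall v, att v \subset S, forall v, #|att v| <= l,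
        forall A : {set T}, #|A| = l -> #|[set v in ~: S | att v == A]| <= q &
        \sum_(v in ~: S) #|att v| = (l - 1) * #|~: S| + q * 'C(#|S|, l)].
Proof.
move=> /andP[l0 lS] cT.
pose L := [set A : {set T} | A \subset S & #|A| == l].
have cL : #|L| = 'C(#|S|, l) by rewrite cards_draws.
have [|A0 A0S cA0] := @exists_subset_card _ S (l - 1); first by lia.
pose idx v := index v (enum (~: S)).
pose att v := if idx v < q * #|L| then nth A0 (enum L) (idx v %/ q) else A0.
have attL v : idx v < q * #|L| -> att v \in L.
  move=> lt_v; rewrite /att lt_v -mem_enum mem_nth // -cardE.
  by rewrite ltn_divLR 1?mulnC //; case: (q) lt_v.
have cattL v : idx v < q * #|L| -> #|att v| = l.
  by move/attL; rewrite inE => /andP[_ /eqP].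
exists att; split=> [v|v|A cA|].
- have [/attL|ge_v] := ltnP (idx v) (q * #|L|); first by rewrite inE => /andP[].
  by rewrite /att ltnNge ge_v.
- have [/cattL->//|ge_v] := ltnP (idx v) (q * #|L|).
  by rewrite /att ltnNge ge_v /= cA0 leq_subr.
- have [->|/set0Pn[v0 _]] := eqVneq [set v in ~: S | att v == A] set0.
    by rewrite cards0.
  (* The vertices attached to [A] have indices in the block of length [q] starting at [j * q]. *)
  pose j := index A (enum L).
  apply: leq_trans (_ : size [seq nth v0 (enum (~: S)) i | i <- iota (j * q) q] <= _).
    apply: leq_trans (card_size _); apply: subset_leq_card; apply/subsetP => v.
    rewrite in_set => /andP[vS /eqP attv]; apply/mapP; exists (idx v); last first.
      by rewrite nth_index // mem_enum.
    have lt_v : idx v < q * #|L|.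
      rewrite ltnNge; apply/negP => ge_v; move: cA; rewrite -attv /att ltnNge ge_v /= cA0.
      by lia.
    have q0 : 0 < q by case: (q) lt_v.
    have <- : idx v %/ q = j.
      rewrite /j -attv /att lt_v index_uniq ?enum_uniq // -cardE.
      by rewrite ltn_divLR 1?mulnC.
    by rewrite mem_iota leq_divM /= -mulSnr ltn_ceil.
  by rewrite size_map size_iota.
have -> : \sum_(v in ~: S) #|att v| = \sum_(v in ~: S) ((l - 1) + (idx v < q * #|L|)).
  apply: eq_bigr => v _; have [/cattL->|ge_v] := ltnP (idx v) (q * #|L|); first by lia.
  by rewrite /att ltnNge ge_v /= cA0 addn0.
rewrite big_split sum_nat_const /= mulnC -cL; congr (_ + _).
have ltN : q * #|L| <= size (enum (~: S)).
  by rewrite -cardE cL; have := cardsC S; rewrite -/#|T|; lia.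
rewrite -[RHS](size_takel ltN) -(card_uniqP _) ?take_uniq ?enum_uniq //.
rewrite -[RHS]sum1_card (_ : \sum_(v in ~: S) (idx v < q * #|L|) = \sum_(v in ~: S | idx v < q * #|L|) 1); last by rewrite big_mkcondr.
apply: eq_bigl => v.
have [vS|vS] := boolP (v \in ~: S); first by rewrite in_take ?mem_enum.
by apply/esym/negP => /mem_take; rewrite mem_enum (negPf vS).
Qed.

Definition attached_graph (T : finType) (S : {set T}) (F : {set {set T}})
    (att : T -> {set T}) : {set {set T}} :=
  F :|: [set e | [exists v in ~: S, exists a in att v, e == [set v; a]]].

Section AttachedGraph.

Variables (T : finType) (S : {set T}) (F : {set {set T}}) (att : T -> {set T}).
Hypothesis sF : simple F.
Hypothesis FS : {in F, forall e : {set T}, e \subset S}.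
Hypothesis attS : forall v, att v \subset S.

Let G := attached_graph S F att.

Lemma attached_graphP (e : {set T}) :
  reflect (e \in F \/ exists v a, [/\ v \notin S, a \in att v & e = [set v; a]]) (e \in G).
Proof.
rewrite !inE; apply: (iffP orP) => -[eF|]; try by left.
  move=> /exists_inP[v vS /exists_inP[a av /eqP ->]]; right; exists v, a; split=> //.
  by rewrite inE in vS.
move=> [v [a [vS av ->]]]; right; apply/exists_inP; exists v; first by rewrite inE.
by apply/exists_inP; exists a.
Qed.

Lemma simple_attached : simple G.
Proof.
move=> e /attached_graphP[/sF //|[v [a [vS av ->]]]]; rewrite cards2.
by case: eqP => // va; rewrite va (subsetP (attS v)) in vS.
Qed.

Lemma attached_cover (x y : T) : [set x; y] \in G -> (x \in S) || (y \in S).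
Proof.
case/attached_graphP=> [/FS|[v [a [vS /(subsetP (attS v)) aS]]]].
  by rewrite subUset !sub1set => /andP[->].
by move/setP/(_ a); rewrite !inE eqxx orbT => /orP[]/eqP<-; rewrite aS ?orbT.
Qed.

Lemma nbr_attached_out (v : T) : v \notin S -> nbr G v = att v.
Proof.
move=> vS; apply/setP => y; rewrite inE; apply/attached_graphP/idP => [|yv]; last first.
  by right; exists v, y.
case=> [/FS|[u [a [uS au]]]]; first by rewrite subUset sub1set (negPf vS).
have aS := subsetP (attS u) _ au; move=> eq_vy.
have va : v != a by apply: contraNneq vS => ->.
have : v \in [set u; a] by rewrite -eq_vy !inE eqxx.
rewrite !inE (negPf va) orbF => /eqP vu; move: eq_vy; rewrite vu => /set2_inj ->.
exact: au.
Qed.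

Lemma nbr_attached_in (x : T) : x \in S -> nbr G x :&: S = nbr F x.
Proof.
move=> xS; apply/setP => y; rewrite in_setI !in_nbr.
apply/andP/idP => [[/attached_graphP[//|[v [a [vS av eq_xy]]]] yS]|xyF].
  have : v \in [set x; y] by rewrite eq_xy !inE eqxx.
  by rewrite !inE => /orP[]/eqP vE; rewrite vE ?xS ?yS in vS.
split; first by apply/attached_graphP; left.
by have := FS xyF; rewrite subUset !sub1set => /andP[].
Qed.

Lemma card_attached : 2 * #|G| = 2 * #|F| + 2 * \sum_(v in ~: S) #|att v|.
Proof.
rewrite (sum_nbr_cover simple_attached attached_cover) -(sum_incident_on sF FS).
congr (_ + 2 * _); apply: eq_bigr => x xS.
  by rewrite nbr_attached_in // card_incident.
rewrite nbr_attached_out; last by rewrite inE in xS.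
by rewrite (setIidPl (attS x)).
Qed.

(** Every edge of [G] meets [S], and the edges of a matching do so in distinct vertices. *)
Lemma matching_attached (M : {set {set T}}) : M \subset G -> trivIset M -> #|M| <= #|S|.
Proof.
move=> MG tM.
apply: leq_trans (_ : #|cover M :&: S| <= _); last exact/subset_leq_card/subsetIr.
rewrite (card_sum_matching tM (subsetIl _ _)) -sum1_card; apply: leq_sum => e eM.
have /eqP/cards2P[x [y [_ def_e]]] := simple_attached (subsetP MG _ eM).
have := subsetP MG _ eM; rewrite def_e => /attached_cover S_xy.
rewrite card_gt0; apply/set0Pn; rewrite -def_e.
by case/orP: S_xy => zS; [exists x | exists y];
  rewrite !inE zS (mem_cover eM) def_e !inE eqxx ?orbT.
Qed.

(** For [l] vertices of [S] there is no common neighbour inside [S], where degrees are at most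
    [l - 1], and a common neighbour outside is attached to exactly these vertices. *)
Lemma Klt_free_attached (l t : nat) :
    0 < l <= t -> (forall x, #|incident F x| <= l - 1) -> (forall v, #|att v| <= l) ->
    (forall A : {set T}, #|A| = l -> #|[set v in ~: S | att v == A]| <= t - 1) ->
  Klt_free l t G.
Proof.
move=> /andP[l0 lt] dF catt fib.
(* An inequality on [#|A|], since [core] is also applied with the roles of the two parts swapped. *)
have core (A B : {set T}) : A \subset S -> l <= #|A| ->
    {in B, forall b, A \subset nbr G b} -> #|B| < t.
  move=> AS lA AB.
  have BP b : b \in B -> b \notin S /\ att b = A.
    move=> bB; have := AB b bB; have [bS|bS] := boolP (b \in S).
      move=> An; have : A \subset nbr F b by rewrite -nbr_attached_in // subsetI An.
      move/subset_leq_card; have := dF b; rewrite card_incident //; lia.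
    rewrite nbr_attached_out // => Aatt; split=> //.
    by apply/esym/eqP; rewrite eqEcard Aatt (leq_trans (catt b)).
  have [->|/set0Pn[b0 b0B]] := eqVneq B set0; first by rewrite cards0; lia.
  have cA : #|A| = l by have [_ <-] := BP _ b0B; have := catt b0; have [_ ->] := BP _ b0B; lia.
  have : B \subset [set v in ~: S | att v == A].
    by apply/subsetP => b /BP[bS attb]; rewrite !inE bS attb eqxx.
  by move/subset_leq_card; have := fib A cA; lia.
move=> A cA; set C := [set x | _].
have CP c : c \in C -> A \subset nbr G c by rewrite inE.
have [AS|/subsetPn[a aA aS]] := boolP (A \subset S); first by apply: (core A) => //; rewrite cA.
rewrite ltnNge; apply/negP => tC.
have Ca : C \subset att a.
  apply/subsetP => c /CP/subsetP/(_ a aA); rewrite in_nbrC.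
  by rewrite nbr_attached_out.
(* The swapped use gives [l < t], whereas [C] has at least [t] elements within [att a], of size at
   most [l]. *)
have : #|A| < t.
  apply: (core C); [exact: subset_trans Ca (attS a) | exact: leq_trans tC |].
  by move=> b bA; apply/subsetP => c /CP/subsetP/(_ b bA); rewrite in_nbrC.
by have := subset_leq_card Ca; have := catt a; rewrite cA; lia.
Qed.

End AttachedGraph.

(** * Evaluation of the extremal number *)

Lemma has_matchingPn (n k : nat) (E : {set {set 'I_n}}) :
  reflect (forall M : {set {set 'I_n}}, M \subset E -> trivIset M -> #|M| <= k)
          (~~ has_matching k.+1 E).
Proof.
apply: (iffP idP) => [noM M ME tM|noM].
  rewrite leqNgt; apply: contra noM => /exists_subset_card[N NM cN].
  apply/existsP; exists N; rewrite cN eqxx (subset_trans NM ME).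
  exact: trivIsetS tM.
apply/existsP => -[M /and3P[ME /eqP cM tM]].
by have := noM M ME tM; rewrite cM ltnn.
Qed.

Lemma simple_graphP (n : nat) (E : {set {set 'I_n}}) :
  reflect (simple E) (simple_graph E).
Proof. by apply: (iffP forall_inP) => sE e /sE/eqP. Qed.

Theorem theorem1p2 (l t : nat) :
  3 <= l <= t ->
  exists S : nat, forall s n : nat,
    S <= s ->
    s + (t - 1) * 'C(s, l) + 1 <= n ->
    ex_Klt_M n l t s =
      (l - 1) * n + (t - 1) * 'C(s, l) - (s * (l - 1) + 1) %/ 2.
Proof.
move=> lt3; have /andP[l3 lt] := lt3.
(* The last bracket is the size that a nearly regular graph with [d = l - 1] requires; the rest
   serves the upper bound. *)
exists (8 * l + 2 * (t - 1) * 8 ^ l + 20 + (4 * l * (l - 1) + 2)) => s n le_s le_n.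
have ls1 : 8 * l + 2 * (t - 1) * 8 ^ l + 20 <= s by apply: leq_trans le_s; apply: leq_addr.
have ls2 : 4 * l * (l - 1) + 2 <= s by apply: leq_trans le_s; apply: leq_addl.
have ls3 : l <= s.
  by apply: leq_trans ls1; rewrite -!addnA (leq_trans _ (leq_addr _ _)) // leq_pmull.
have sn : s <= n by apply: leq_trans le_n; rewrite -addnA leq_addr.
apply/eqP; rewrite eqn_leq; apply/andP; split.
  apply/bigmax_leqP => E /and3P[/simple_graphP sE /(has_KltPn _ _ sE) freeE /has_matchingPn noM].
  by have := edges_upper lt3 ls1 sE freeE noM; rewrite card_ord; lia.
have [|S _ cS] := @exists_subset_card _ [set: 'I_n] s.
  by rewrite cardsT card_ord.
have [||F [sF FS dF cF]] := @exists_near_regular _ S (l - 1); first by lia.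
  by rewrite cS; have -> : (l - 1).+1 = l by lia.
have [||att [attS catt fib catt_sum]] := @exists_attachment _ S l (t - 1).
- by rewrite cS ls3; lia.
- by rewrite cS card_ord; lia.
pose G := attached_graph S F att.
have sG : simple G by apply: simple_attached.
apply: leq_trans (_ : #|G| <= _); last first.
  apply: leq_bigmax_cond; apply/and3P; split; first exact/simple_graphP.
    by apply/(has_KltPn _ _ sG); apply: (Klt_free_attached sF FS attS) => //; lia.
  apply/has_matchingPn => M MG tM; rewrite -cS.
  exact: (matching_attached sF FS attS MG tM).
have := card_attached sF FS attS; rewrite -/G catt_sum.
have : #|~: S| = n - s by have := cardsC S; rewrite cS card_ord; lia.
(* [F] has at least the floor of [(l - 1) * s / 2] edges, so replacing [(l - 1) * s] by [#|F|] loses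
   at most the ceiling that is subtracted. *)
move=> ->; rewrite mulnBr; move: cF; rewrite cS.
have : (l - 1) * s <= (l - 1) * n by rewrite leq_mul2l; apply/orP; right; lia.
by rewrite [s * _]mulnC; lia.
Qed.
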